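(* Let $n\ge 2$. Then $$c(n,4)=4+\frac4n,$$ and a measure $\mu\in\mathcal{P}_0(\mathbb{S}^{n-1})$ minimizes $J_4$ over $\mathcal{P}_0(\mathbb{S}^{n-1})$ if and only if it satisfies the isotropy condition $$\int_{\mathbb{S}^{n-1}}v_i\,v_j\,d\mu(v)=\frac1n\,\delta_{ij},\qquad i,j=1,\dots,n.$$ In particular, both $\sigma_{n-1}$ and $\mu_{\rm sim}$ are minimizers.
   Context: $\mathcal{P}_0(\mathbb{S}^{n-1})$ is the set of Borel probability measures $\mu$ on the unit sphere $\mathbb{S}^{n-1}\subset\mathbb{R}^n$ with barycenter $\int v\,d\mu(v)=0$. $J_4(\mu)=\iint_{\mathbb{S}^{n-1}\times\mathbb{S}^{n-1}}|v-w|^4\,d\mu(v)\,d\mu(w)$ and $c(n,4)=\inf_{\mu\in\mathcal{P}_0(\mathbb{S}^{n-1})}J_4(\mu)$. $\sigma_{n-1}=\mathcal{H}^{n-1}(\mathbb{S}^{n-1})^{-1}\mathcal{H}^{n-1}\lfloor_{\mathbb{S}^{n-1}}$ is the uniform probability measure on the sphere. $\mu_{\rm sim}=\frac1{n+1}\sum_{i=0}^n\delta_{v_i}$, where $v_0,\dots,v_n\in\mathbb{S}^{n-1}$ are the vertices of a regular $n$-simplex inscribed in $\mathbb{S}^{n-1}$ (distinct points with $|v_i-v_j|$ constant for $i\ne j$); it is defined up to rotations. *)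

(* Defs.v *)
From HB Require Import structures.
From mathcomp Require Import all_boot all_order all_algebra.
From mathcomp Require Import all_classical all_reals all_analysis.

Set Implicit Arguments.
Unset Strict Implicit.
Unset Printing Implicit Defensive.
Import Order.TTheory GRing.Theory Num.Theory.
Import numFieldNormedType.Exports.
Local Open Scope classical_set_scope.
Local Open Scope ring_scope.

(* The norm carried by 'rV[R]_n in MathComp-Analysis is the sup norm; the
   Euclidean norm induces the same topology, hence the same Borel sets. *)
Definition enorm (R : realType) (n : nat) (v : 'rV[R]_n) : R :=
  Num.sqrt (\sum_(i < n) v ord0 i ^+ 2).

Definition sphere (R : realType) (n : nat) : set 'rV[R]_n :=
  [set v | enorm v = 1].

Definition borelRn (R : realType) (n : nat) :=
  g_sigma_algebraType (@open 'rV[R]_n).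

Section Energy.
Context {R : realType} {n : nat}.
Implicit Type mu : probability (borelRn R n) R.

Definition barycenter mu : 'rV[R]_n :=
  \row_(i < n) (\int[mu]_(v in @sphere R n) ((v : 'rV[R]_n) ord0 i))%R.

(* Borel probability measures on the sphere are identified with the Borel
   probability measures on R^n that give the sphere full mass. *)
Definition P0 : set (probability (borelRn R n) R) :=
  [set mu : probability (borelRn R n) R |
     mu (@sphere R n) = 1%E /\ barycenter mu = 0].

Definition J4 mu : \bar R :=
  (\int[mu]_(w in @sphere R n) \int[mu]_(v in @sphere R n)
     (enorm ((v : 'rV[R]_n) - (w : 'rV[R]_n)) ^+ 4)%:E)%E.

Definition minimizes_J4 mu : Prop :=
  P0 mu /\ forall nu, P0 nu -> (J4 mu <= J4 nu)%E.

Definition isotropic mu : Prop :=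
  forall i j : 'I_n,
    (\int[mu]_(v in @sphere R n)
       ((v : 'rV[R]_n) ord0 i * (v : 'rV[R]_n) ord0 j)%:E)%E
    = (n%:R^-1 * (i == j)%:R)%:E.

End Energy.

Definition c4 (R : realType) (n : nat) : \bar R :=
  ereal_inf [set J4 mu | mu in @P0 R n].

Section Hausdorff.
Context {R : realType} {n : nat}.
Implicit Types (A : set 'rV[R]_n) (s : nat) (delta : R).

(* Adjoining 0 only matters for the empty set, whose diameter is thus 0. *)
Definition diam A : \bar R :=
  ereal_sup (0%E |` [set (enorm (xy.1 - xy.2))%:E | xy in A `*` A]).

Definition hausdorff_content s delta A : \bar R :=
  ereal_inf [set (\sum_(0 <= k <oo) diam (U k) ^+ s)%E | U in
    [set U : (set 'rV[R]_n)^nat |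
      A `<=` \bigcup_k U k /\ forall k, (diam (U k) <= delta%:E)%E]].

(* The s-dimensional Hausdorff outer measure, for an integer s > 0, without the
   dimensional factor omega_s / 2 ^ s: that factor cancels in is_uniform. The
   supremum is the limit as delta tends to 0, by monotonicity in delta. *)
Definition hausdorff s A : \bar R :=
  ereal_sup [set hausdorff_content s delta A | delta in [set d | 0 < d]].

Definition is_uniform (sigma : probability (borelRn R n) R) : Prop :=
  forall A : set (borelRn R n), measurable A ->
    sigma A = ((hausdorff n.-1 (@sphere R n))^-1
               * hausdorff n.-1 (A `&` @sphere R n))%E.

End Hausdorff.

Definition regular_simplex (R : realType) (n : nat) (v : 'I_n.+1 -> 'rV[R]_n) :
    Prop :=
  [/\ forall i, sphere (v i), injective v &
      exists l : R, forall i j, i != j -> enorm (v i - v j) = l].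

Section Simplex.
Context {R : realType} {n : nat}.
Variable v : 'I_n.+1 -> 'rV[R]_n.

(* msum sums a sequence of measures indexed by nat, whence inord. *)
Definition mu_sim : set (borelRn R n) -> \bar R :=
  mscale (n.+1%:R^-1)%:nng
    (msum (fun k => \d_(v (inord k) : borelRn R n)) n.+1).

HB.instance Definition _ := Measure.on mu_sim.

Let mu_sim_setT : mu_sim setT = 1%E.
Proof.
rewrite /mu_sim /mscale /= /msum.
rewrite (eq_bigr (fun=> 1%E)); last by move=> k _; exact: diracT.
rewrite sumEFin -EFinM; congr EFin.
by rewrite sumr_const card_ord mulVf // pnatr_eq0.
Qed.

HB.instance Definition _ :=
  Measure_isProbability.Build _ _ _ mu_sim mu_sim_setT.

End Simplex.

(* Main.v *)
From HB Require Import structures.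
Require Import Defs.
From mathcomp Require Import all_boot all_order all_algebra.
From mathcomp Require Import all_classical all_reals all_analysis.
From mathcomp Require Import perm measurable_realfun ring lra zify.
Import Order.TTheory GRing.Theory Num.Theory.
Import numFieldNormedType.Exports.
Local Open Scope classical_set_scope.
Local Open Scope ring_scope.

Set Implicit Arguments.
Unset Strict Implicit.
Unset Printing Implicit Defensive.

(** On the sphere, |v - w|^4 = (2 - 2 <v, w>)^2 = 4 - 8 <v, w> + 4 <v, w>^2.
Integrating in v and then in w, and using that the barycenter vanishes, gives
J_4(mu) = 4 + 4 * |M|^2, where M is the matrix of second moments of mu and
|M|^2 is the sum of its squared entries ([J4_moments]).  As v has norm 1, M has
trace 1, so that |M|^2 = 1 / n + |M - I / n|^2 ([moment_defect]).  Hence J_4 is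
at least 4 + 4 / n on P_0, with equality exactly when M = I / n, which is
isotropy ([J4_ge], [J4_eq_isotropic]).

The vertices of a regular simplex have a common scalar product c <> 1.  Being
n + 1 vectors in dimension n they are linearly dependent, and the equations of
a linear dependency show that all its coefficients are equal; thus the vertices
add up to 0 and c = - 1 / n ([equiangular_sum0], [equiangular_dot]).  This
places mu_sim in P_0 and gives it the energy 4 + 4 / n ([J4_mu_sim]).  An
explicit simplex then shows that the lower bound is attained.

A uniform measure sigma is invariant under the coordinate reflections and
transpositions, because these are isometries and Hausdorff measure only depends
on distances ([mean_signed_perm]).  Reflections kill the first moments and the
off-diagonal second moments; transpositions make the diagonal ones equal, hence
equal to 1 / n.

The existence of sigma is the longest part.  The Hausdorff outer measure is
additive on sets at a positive distance ([hausdorff_sep]); by the Caratheodory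
criterion ([separated_caratheodory]) its restriction to the Borel sets is
countably additive ([hausdorff_sigma_additive]).  It remains to see that the
(n-1)-dimensional measure of the sphere is finite and positive.
- Finite: on the part of the sphere where the i-th coordinate dominates, the
  sphere is a Lipschitz graph over the other n - 1 coordinates, so a grid of
  mesh 1 / N in these coordinates cuts it into O(N^(n-1)) cells of diameter
  O(1 / N) ([hausdorff_sphere_bound]).
- Positive: after a slight enlargement, compactness reduces any cover to a
  finite one.  Lifting to the sphere the N^(n-1) points of a small grid in
  the last n - 1 coordinates, a set of diameter D contains O((N D)^(n-1)) of
  them when N D >= 1, so the sum of the D^(n-1) is bounded below
  ([sphere_cover_lower], [hausdorff_sphere_gt0]). *)

(** * The Euclidean norm and the sphere *)

Section EuclideanNorm.
Context {R : realType} {n : nat}.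
Implicit Types (u v x y : 'rV[R]_n).

Lemma enorm_ge0 v : 0 <= enorm v.
Proof. exact: sqrtr_ge0. Qed.

Lemma sqr_enorm v : enorm v ^+ 2 = \sum_(i < n) v ord0 i ^+ 2.
Proof. by rewrite sqr_sqrtr// sumr_ge0// => i _; rewrite sqr_ge0. Qed.

Lemma coord_le_enorm v i : `|v ord0 i| <= enorm v.
Proof.
rewrite -sqrtr_sqr ler_wsqrtr// (bigD1 i)//= lerDl.
by rewrite sumr_ge0// => j _; rewrite sqr_ge0.
Qed.

Lemma enorm_le_coord v (c : R) : 0 <= c ->
  (forall i, `|v ord0 i| <= c) -> enorm v <= n%:R * c.
Proof.
move=> c0 vc; rewrite -[leRHS]ger0_norm ?mulr_ge0// -sqrtr_sqr ler_wsqrtr//.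
apply: (@le_trans _ _ (\sum_(i < n) c ^+ 2)).
  by apply: ler_sum => i _; rewrite -[leLHS]real_normK ?num_real// lerXn2r ?nnegrE.
rewrite sumr_const card_ord exprMn -[leLHS]mulr_natl ler_wpM2r ?sqr_ge0//.
by rewrite -natrX ler_nat; case: n => // k; rewrite leq_pmulr.
Qed.

Lemma norm_le_enorm v : `|v| <= enorm v.
Proof.
rewrite [leLHS]mx_normrE; apply/bigmax_leP; split; first exact: enorm_ge0.
by move=> [i j] _ /=; rewrite ord1 coord_le_enorm.
Qed.

Lemma norm_coord_le v i : `|v ord0 i| <= `|v|.
Proof.
by rewrite [leRHS]mx_normrE; apply: (le_bigmax _ _ (ord0, i)).
Qed.

Lemma sphere_sum_sqr x : sphere x -> \sum_j x ord0 j ^+ 2 = 1.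
Proof. by rewrite -sqr_enorm => ->; rewrite expr1n. Qed.

Lemma sphere_coord_le1 x j : sphere x -> `|x ord0 j| <= 1.
Proof. by move=> <-; exact: coord_le_enorm. Qed.

Definition dot u v : R := \sum_i u ord0 i * v ord0 i.

Lemma dotC u v : dot u v = dot v u.
Proof. by apply: eq_bigr => i _; rewrite mulrC. Qed.

Lemma sphere_dotP v : sphere v <-> dot v v = 1.
Proof.
have E : dot v v = enorm v ^+ 2.
  by rewrite sqr_enorm; apply: eq_bigr => i _; rewrite expr2.
split=> [Sv|vv]; first by rewrite E [enorm v]Sv expr1n.
by apply/eqP; rewrite -(@eqrXn2 _ 2)// ?enorm_ge0// expr1n -E vv.
Qed.

Lemma sqr_enormB u v : sphere u -> sphere v ->
  enorm (u - v) ^+ 2 = 2 - 2 * dot u v.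
Proof.
move=> Su Sv; rewrite sqr_enorm.
transitivity (\sum_i (u ord0 i ^+ 2 + v ord0 i ^+ 2
    + (- 2) * (u ord0 i * v ord0 i))).
  by apply: eq_bigr => i _; rewrite !mxE; ring.
by rewrite !big_split/= -mulr_sumr !sphere_sum_sqr// -/(dot u v); ring.
Qed.

End EuclideanNorm.

Section SphereTopology.
Context {R : realType} {n : nat}.

Lemma continuous_sum (T : topologicalType) (I : Type) (r : seq I)
    (F : I -> T -> R) :
  (forall i, continuous (F i)) -> continuous (fun x => \sum_(i <- r) F i x).
Proof.
move=> cF x; elim: r => [|i r IH].
  by under eq_fun do rewrite big_nil; exact: cst_continuous.
under eq_fun do rewrite big_cons.
by apply: continuousD; [exact: cF|exact: IH].
Qed.

Lemma sphere_closed : closed (@sphere R n).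
Proof.
have -> : @sphere R n = (fun v : 'rV[R]_n => \sum_i v ord0 i ^+ 2) @^-1` [set 1].
  apply/seteqP; split => v /=; first exact: sphere_sum_sqr.
  by rewrite /sphere /enorm /= => ->; rewrite sqrtr1.
apply: preimage_closed; last exact: closed_eq.
move=> v _; apply: continuous_sum => i {}v.
apply: (@continuous_comp _ _ _ (fun v : 'rV[R]_n => v ord0 i) (fun x => x ^+ 2)).
  exact: coord_continuous.
exact: exprn_continuous.
Qed.

Lemma sphere_compact : compact (@sphere R n).
Proof.
apply: bounded_closed_compact; last exact: sphere_closed.
exists 1; split; first by rewrite num_real.
move=> M M1 v /= Sv; rewrite (le_trans (norm_le_enorm _))//.
by rewrite [enorm v]Sv ltW.
Qed.

End SphereTopology.

(** * Separated sets and the Caratheodory criterion *)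

(** The additivity hypothesis only compares sets whose values under [f] are
separated by a gap.  With [f] the distance to a closed set, this yields the
usual criterion for metric outer measures. *)
Section SeparatedCaratheodory.
Local Open Scope ereal_scope.
Context {R : realType} {T : Type}.
Variable mu : {outer_measure set T -> \bar R}.
Variable f : T -> R.

Hypothesis additive_sep : forall (A B : set T) (e : R), (0 < e)%R ->
  (forall x y, A x -> B y -> (e <= f y - f x)%R) -> mu A + mu B <= mu (A `|` B).

(** Only the inequality mu (X & f <= 0) + mu (X & f > 0) <= mu X is at stake.
The set where [f >= a k] is separated from the set where [f <= 0], so it is
enough to approximate the measure of X & f > 0 by that of the sets
E k = X & f >= a k, with a k decreasing to 0.  What is missing is covered by
the shells D m = X & a (m+1) <= f < a m, so it suffices that their measures be
summable.  As D (m+1) is separated from E m and both lie in E (m+2), we have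
mu (D (m+1)) + mu (E m) <= mu (E (m+2)), and these inequalities telescope. *)
Lemma separated_caratheodory : mu.-caratheodory [set x | (f x <= 0)%R].
Proof.
apply: le_caratheodory_measurable => X.
set Z := X `&` [set x | (f x <= 0)%R]; set P := X `&` _.
have [Xfin|Xoo] := ltP (mu X) +oo; last first.
  by rewrite (_ : mu X = +oo) ?leey//; apply/eqP; rewrite -leye_eq.
have mu_le A : A `<=` X -> mu A <= mu X by exact: le_outer_measure.
have mu_fin A : A `<=` X -> mu A \is a fin_num.
  move=> /mu_le AX; rewrite ge0_fin_numE ?outer_measure_ge0//.
  exact: le_lt_trans AX Xfin.
pose a k : R := (k.+1%:R^-1)%R.
have a_dec k : (a k.+1 < a k)%R by rewrite /a ltf_pV2 ?posrE// ltr_nat.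
pose E k := X `&` [set x | (a k <= f x)%R].
pose D k := X `&` [set x | (a k.+1 <= f x < a k)%R].
have EX k : E k `<=` X by move=> x [].
have DX k : D k `<=` X by move=> x [].
have DE m : mu (D m.+1) + mu (E m) <= mu (E m.+2).
  apply: (le_trans (additive_sep (e := a m - a m.+1) _ _)).
  - by rewrite subr_gt0.
  - by move=> x y [_ /= /andP[_ xm]] [_ /= ym]; rewrite lerB// ltW.
  - apply: le_outer_measure => x [[Xx /= /andP[xm _]]|[Xx /= xm]]; split => //=.
    by rewrite (le_trans _ xm)// ltW// (lt_trans (a_dec _)).
have sumD M : \sum_(0 <= m < M) mu (D m.+1) <= mu (E M.+1) + mu (E M).
  elim: M => [|M IH]; first by rewrite big_geq// adde_ge0 ?outer_measure_ge0.
  rewrite big_nat_recr//= (le_trans (leeD2r _ IH))//.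
  by rewrite -addeA addeC leeD2r// addeC DE.
have sumD_fin : \sum_(0 <= m <oo) mu (D m.+1) < +oo.
  apply: (@le_lt_trans _ _ (mu X + mu X)).
    apply: lime_le.
      by apply: is_cvg_nneseries => *; exact: outer_measure_ge0.
    by apply: nearW => M; rewrite (le_trans (sumD M))// leeD// mu_le.
  by rewrite lte_add_pinfty.
have PE k : mu P <= mu (E k.+1) + \sum_(k <= m <oo) mu (D m.+1).
  apply: (@le_trans _ _ (mu (E k.+1 `|` \bigcup_(m in ~` `I_k) D m.+1))).
    apply: le_outer_measure => x [Xx] /= /negP; rewrite -ltNge => fx.
    have [|fxk] := leP (a k.+1) (f x); first by left.
    right.
    (* The first N with a (N+1) <= f x is the index of the shell of x; it is at
       least k + 1 because f x < a (k+1). *)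
    have exN : exists N, (a N.+1 <= f x)%R.
      have [N _ /(_ _ (leqnn N))/= aN] := near_infty_natSinv_lt (PosNum fx).
      by exists N; rewrite (le_trans (ltW (a_dec N)))// ltW.
    have [N aN minN] := ex_minnP exN.
    have kN : (k < N)%N.
      rewrite ltnNge; apply/negP => Nk; move: fxk; rewrite ltNge => /negP; apply.
      apply: le_trans aN; rewrite /a lef_pV2 ?posrE// ler_nat.
      by rewrite !ltnS.
    case: N kN aN minN => // N kN aN minN.
    exists N; first by move/negP: kN => /=; lia.
    split => //=; rewrite aN/= ltNge; apply/negP => aN'.
    by have := minN _ aN'; rewrite ltnn.
  rewrite (le_trans (outer_measureU2 _ _ _))// leeD2l//.
  exact: (outer_measure_sigma_subadditive_tail mu k (fun m => D m.+1)).
have ZE k : mu Z + mu (E k) <= mu X.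
  apply: (le_trans (additive_sep (e := a k) _ _)).
  - by rewrite invr_gt0.
  - by move=> x y [_ /= x0] [_ /= yk]; rewrite -[a k]subr0 lerB.
  - by apply: mu_le => x [[]|[]].
have ZPk k : mu Z + mu P <= mu X + \sum_(k <= m <oo) mu (D m.+1).
  by rewrite (le_trans (leeD2l _ (PE k)))// addeA leeD2r.
apply/lee_addgt0Pr => e e0.
have /fine_cvgP[_ /cvgrPdist_lt/(_ _ e0)] :=
  nneseries_tail_cvg sumD_fin (fun k _ => outer_measure_ge0 mu (D k.+1)).
move=> [N _ /(_ _ (leqnn N))/=]; rewrite sub0r normrN => Ne.
rewrite (le_trans (ZPk N))// leeD2l//.
have tail_fin : \sum_(N <= m <oo) mu (D m.+1) \is a fin_num.
  rewrite ge0_fin_numE; last by apply: nneseries_ge0 => *; exact: outer_measure_ge0.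
  apply: le_lt_trans sumD_fin.
  rewrite [leRHS](nneseries_split _ N); last by move=> *; exact: outer_measure_ge0.
  by rewrite add0n leeDr// sume_ge0// => *; exact: outer_measure_ge0.
rewrite -(fineK tail_fin) lee_fin ltW// (le_lt_trans _ Ne)// ler_norm//.
Qed.

End SeparatedCaratheodory.

Section Distance.
Context {R : realType} {V : normedModType R}.
Implicit Types (C : set V) (x y : V).

Definition dist C x : R := inf [set `|x - c| | c in C].

Lemma dist_has_inf C x : C !=set0 -> has_inf [set `|x - c| | c in C].
Proof.
move=> [c Cc]; split; first by exists `|x - c|, c.
by exists 0 => _ [d _ <-].
Qed.

Lemma dist_lipschitz C x y : C !=set0 -> dist C y - dist C x <= `|x - y|.
Proof.
move=> C0; rewrite lerBlDr -lerBlDl.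
apply: lb_le_inf; first exact: (dist_has_inf x C0).1.
move=> _ [c Cc <-]; rewrite lerBlDl.
apply: (@le_trans _ _ `|y - c|).
  by apply: ge_inf; [exact: (dist_has_inf y C0).2|exists c].
by rewrite (distrC x y) ler_distD.
Qed.

Lemma dist_le0 C x : C !=set0 -> closed C -> dist C x <= 0 <-> C x.
Proof.
move=> C0 cC; split=> [d0|Cx].
  apply: cC => U /nbhs_ballP[e /= e0 eU].
  have := inf_adherent e0 (dist_has_inf x C0).
  move=> [_ [c Cc <-]]; rewrite -/(dist C x) => ce.
  exists c; split => //; apply: eU; rewrite -ball_normE /ball_/=.
  by rewrite (lt_le_trans ce)// gerDr.
apply: ge_inf; first exact: (dist_has_inf x C0).2.
by exists x => //; rewrite subrr normr0.
Qed.

End Distance.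

(** * Hausdorff measure as a Borel measure *)

Section HausdorffOuterMeasure.
Local Open Scope ereal_scope.
Context {R : realType} {n : nat}.
Implicit Types (A B U : set 'rV[R]_n) (s : nat) (delta : R).

Lemma lee_expe (x y : \bar R) k : 0 <= x -> x <= y -> x ^+ k <= y ^+ k.
Proof.
move=> x0 xy; elim: k => [//|k IH].
by rewrite !expeS lee_pmul// expe_ge0.
Qed.

Lemma diam_ge0 A : 0 <= diam A.
Proof. by apply: ereal_sup_ubound; left. Qed.

Lemma enorm_le_diam A x y : A x -> A y -> (enorm (x - y))%:E <= diam A.
Proof. by move=> Ax Ay; apply: ereal_sup_ubound; right; exists (x, y). Qed.

Lemma diam_le A (b : \bar R) : 0 <= b ->
  (forall x y, A x -> A y -> (enorm (x - y))%:E <= b) -> diam A <= b.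
Proof.
move=> b0 Ab; apply: ge_ereal_sup => _ [->//|[[x y] [/= Ax Ay] <-]].
exact: Ab.
Qed.

Lemma le_diam A B : A `<=` B -> diam A <= diam B.
Proof.
move=> AB; apply: diam_le; first exact: diam_ge0.
by move=> x y /AB Bx /AB By; exact: enorm_le_diam.
Qed.

Lemma diam0 : diam (set0 : set 'rV[R]_n) = 0.
Proof.
by apply/eqP; rewrite eq_le diam_ge0 andbT; apply: diam_le.
Qed.

(** The size attached to a set when covers are allowed to use any set: charging
[+oo] for the sets of diameter above [delta] has the same effect as excluding
them, and turns the content into the outer measure of the general construction
by covers. *)
Definition gauge s delta U : \bar R :=
  if diam U <= delta%:E then diam U ^+ s.+1 else +oo.

Lemma gauge_ge0 s delta U : 0 <= gauge s delta U.
Proof. by rewrite /gauge; case: ifP => // _; rewrite expe_ge0// diam_ge0. Qed.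

Lemma gauge0 s delta : (0 < delta)%R -> gauge s delta set0 = 0.
Proof.
by move=> d0; rewrite /gauge diam0 lee_fin ltW// expeS mul0e.
Qed.

(** The sigma-algebra of all subsets: the content is defined with covers by
arbitrary sets. *)
Let discreteRn := g_sigma_algebraType [set: set 'rV[R]_n].

Lemma hausdorff_content_mu_ext s delta A :
  hausdorff_content s.+1 delta A = @mu_ext _ discreteRn R (gauge s delta) A.
Proof.
apply/eqP; rewrite eq_le; apply/andP; split.
  apply: le_ereal_inf_tmp => _ [F [_ AF] <-].
  have [Fd|] := pselect (forall k, diam (F k) <= delta%:E).
    apply: ereal_inf_lbound; exists F => //.
    by apply: eq_eseriesr => k _; rewrite /gauge Fd.
  move=> /existsNP[k /negP Fk].
  rewrite (@eseries_pinfty _ _ _ k) ?leey//; last by rewrite /gauge (negbTE Fk).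
  by move=> i _; rewrite gt_eqF// (lt_le_trans _ (gauge_ge0 _ _ _)).
apply: le_ereal_inf_tmp => _ [F [AF Fd] <-].
apply: ereal_inf_lbound; exists F.
  by split => // i; exact: sub_sigma_algebra.
by apply: eq_eseriesr => k _; rewrite /gauge Fd.
Qed.

Lemma hausdorff_content_ge0 s delta A : 0 <= hausdorff_content s.+1 delta A.
Proof. by rewrite hausdorff_content_mu_ext; exact/mu_ext_ge0/gauge_ge0. Qed.

Lemma content_le_hausdorff s delta A : (0 < delta)%R ->
  hausdorff_content s delta A <= hausdorff s A.
Proof. by move=> d0; apply: ereal_sup_ubound; exists delta. Qed.

Lemma hausdorff0 s : hausdorff s.+1 (set0 : set 'rV[R]_n) = 0.
Proof.
apply/eqP; rewrite eq_le; apply/andP; split.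
  apply: ge_ereal_sup => _ [d d0 <-].
  by rewrite hausdorff_content_mu_ext mu_ext0//; [exact: gauge0|exact: gauge_ge0].
exact: le_trans (hausdorff_content_ge0 s 1 _) (content_le_hausdorff _ _ _).
Qed.

Lemma hausdorff_ge0 s A : 0 <= hausdorff s.+1 A.
Proof.
exact: le_trans (hausdorff_content_ge0 s 1 _) (content_le_hausdorff _ _ _).
Qed.

Lemma le_hausdorff s : {homo (@hausdorff R n s.+1) : A B / A `<=` B >-> A <= B}.
Proof.
move=> A B AB; apply: ge_ereal_sup => _ [d d0 <-].
apply: le_trans (content_le_hausdorff _ _ d0).
by rewrite !hausdorff_content_mu_ext; exact: le_mu_ext.
Qed.

Lemma hausdorff_sigma_subadditive s : sigma_subadditive (@hausdorff R n s.+1).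
Proof.
move=> F; apply: ge_ereal_sup => _ [d d0 <-].
rewrite hausdorff_content_mu_ext.
apply: (le_trans (@mu_ext_sigma_subadditive _ discreteRn R _ (gauge_ge0 s d) F)).
apply: lee_nneseries => [i _ _|i _]; first exact/mu_ext_ge0/gauge_ge0.
by rewrite -hausdorff_content_mu_ext content_le_hausdorff.
Qed.

HB.instance Definition _ s := isOuterMeasure.Build R 'rV[R]_n
  (@hausdorff R n s.+1) (hausdorff0 s) (@hausdorff_ge0 s) (@le_hausdorff s)
  (@hausdorff_sigma_subadditive s).

Lemma diam_setI_sep U A B (e : R) s : (0 < e)%R ->
  (forall x y, A x -> B y -> (e <= enorm (x - y))%R) -> diam U < e%:E ->
  diam (U `&` A) ^+ s.+1 + diam (U `&` B) ^+ s.+1 <= diam U ^+ s.+1.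
Proof.
move=> e0 sepAB Ue.
have D0 : diam (set0 : set 'rV[R]_n) ^+ s.+1 = 0.
  by rewrite diam0 expeS mul0e.
have [->|/set0P[x [Ux Ax]]] := eqVneq (U `&` A) set0.
  by rewrite D0 add0e lee_expe ?diam_ge0 ?le_diam//.
have [->|/set0P[y [Uy By]]] := eqVneq (U `&` B) set0.
  by rewrite D0 adde0 lee_expe ?diam_ge0 ?le_diam//.
have := lt_le_trans Ue (le_trans _ (enorm_le_diam Ux Uy)).
by rewrite ltxx lee_fin sepAB// => /(_ isT).
Qed.

Lemma hausdorff_content_sep s delta A B (e : R) : (0 < e)%R -> (delta < e)%R ->
  (forall x y, A x -> B y -> (e <= enorm (x - y))%R) ->
  hausdorff_content s.+1 delta A + hausdorff_content s.+1 delta B <=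
  hausdorff_content s.+1 delta (A `|` B).
Proof.
move=> e0 de sepAB; apply: le_ereal_inf_tmp => _ [F [ABF Fd] <-].
apply: (@le_trans _ _ (\sum_(0 <= k <oo)
  (diam (F k `&` A) ^+ s.+1 + diam (F k `&` B) ^+ s.+1))); last first.
  apply: lee_nneseries => [k _ _|k _].
    by rewrite adde_ge0// expe_ge0// diam_ge0.
  apply: (diam_setI_sep s e0 sepAB).
  by rewrite (le_lt_trans (Fd k))// lte_fin.
rewrite nneseriesD; [|by move=> *; rewrite expe_ge0 ?diam_ge0..].
apply: leeD; apply: ereal_inf_lbound.
- exists (fun k => F k `&` A) => //; split.
    by move=> x Ax; have [k _ Fkx] := ABF _ (or_introl Ax); exists k.
  by move=> k; rewrite (le_trans (le_diam _) (Fd k))//; exact: subIsetl.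
- exists (fun k => F k `&` B) => //; split.
    by move=> x Bx; have [k _ Fkx] := ABF _ (or_intror Bx); exists k.
  by move=> k; rewrite (le_trans (le_diam _) (Fd k))//; exact: subIsetl.
Qed.

Lemma hausdorff_content_anti s (d1 d2 : R) A : (d1 <= d2)%R ->
  hausdorff_content s d2 A <= hausdorff_content s d1 A.
Proof.
move=> d12; apply: ereal_inf_le_tmp => _ [F [AF Fd] <-]; exists F => //.
by split=> // k; rewrite (le_trans (Fd k))// lee_fin.
Qed.

(** A set of diameter below the gap [e] meets at most one of [A] and [B], so
splitting a fine cover of the union into its traces on [A] and on [B] does not
increase its total size; see [diam_setI_sep] and [hausdorff_content_sep]. *)
Lemma hausdorff_sep s A B (e : R) : (0 < e)%R ->
  (forall x y, A x -> B y -> (e <= enorm (x - y))%R) ->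
  hausdorff s.+1 A + hausdorff s.+1 B <= hausdorff s.+1 (A `|` B).
Proof.
move=> e0 sepAB; set H := hausdorff _ (A `|` B).
have [Hfin|] := ltP H +oo; last by rewrite leye_eq => /eqP ->; rewrite leey.
have HAfin : hausdorff s.+1 A \is a fin_num.
  rewrite ge0_fin_numE ?hausdorff_ge0//.
  by apply: le_lt_trans Hfin; exact/le_hausdorff/subsetUl.
have HBfin d : (0 < d)%R -> hausdorff_content s.+1 d B \is a fin_num.
  move=> d0; rewrite ge0_fin_numE ?hausdorff_content_ge0//.
  apply: le_lt_trans Hfin; apply: le_trans (content_le_hausdorff _ _ d0) _.
  exact/le_hausdorff/subsetUr.
rewrite -leeBrDl//; apply: ge_ereal_sup => _ [d2 d20 <-].
rewrite leeBrDl// -leeBrDr ?HBfin//; apply: ge_ereal_sup => _ [d1 d10 <-].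
rewrite leeBrDr ?HBfin//.
pose d := Num.min (Num.min d1 d2) (e / 2)%R.
have d0 : (0 < d)%R by rewrite !lt_min d10 d20 divr_gt0.
apply: le_trans (content_le_hausdorff _ _ d0).
apply: le_trans (hausdorff_content_sep _ e0 _ sepAB); last first.
  by rewrite gt_min ltr_pdivrMr// ltr_pMr// ltr1n orbT.
by apply: leeD; apply: hausdorff_content_anti; rewrite !ge_min lexx ?orbT.
Qed.

(** The distance to [C] taken here is for the sup norm; it is 1-Lipschitz for the
Euclidean norm too, since the sup norm is the smaller one. *)
Lemma closed_caratheodory s (C : set 'rV[R]_n) : closed C ->
  (@hausdorff R n s.+1).-caratheodory C.
Proof.
move=> cC; have [->|/set0P C0] := eqVneq C set0.
  exact: caratheodory_measurable_set0.
have -> : C = [set x | (dist C x <= 0)%R].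
  by apply/seteqP; split => x /= /(dist_le0 x C0 cC).
apply: separated_caratheodory => A B e e0 sepAB.
apply: (hausdorff_sep s e0) => x y Ax By.
apply: le_trans (norm_le_enorm _); apply: le_trans (dist_lipschitz x y C0).
exact: sepAB.
Qed.

Lemma borel_caratheodory s (A : set (borelRn R n)) : measurable A ->
  (@hausdorff R n s.+1).-caratheodory A.
Proof.
apply: (@smallest_sub _ (sigma_algebra setT) (@open 'rV[R]_n)
  (@hausdorff R n s.+1).-caratheodory).
  split.
  - exact: caratheodory_measurable_set0.
  - by move=> B mB; rewrite setTD; exact: caratheodory_measurable_setC.
  - exact: caratheodory_measurable_bigcup.
move=> U oU; rewrite -[U]setCK; apply: caratheodory_measurable_setC.
by apply: closed_caratheodory; exact: open_closedC.
Qed.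

Lemma hausdorff_sigma_additive s (S : set 'rV[R]_n)
    (F : (set (borelRn R n))^nat) :
  measurable (S : set (borelRn R n)) ->
  (forall k, measurable (F k)) -> trivIset setT F ->
  (fun N => \sum_(0 <= k < N) hausdorff s.+1 (F k `&` S)) @ \oo -->
  hausdorff s.+1 (\bigcup_k F k `&` S).
Proof.
move=> mS mF tF; rewrite setI_bigcupl.
apply: (@caratheodory_measure_sigma_additive R 'rV[R]_n (@hausdorff R n s.+1)
   (fun k => F k `&` S)).
- move=> k; apply: (@borel_caratheodory s); exact: measurableI.
- exact: trivIset_setIr.
- apply: (@borel_caratheodory s); apply: bigcup_measurable => k _.
  exact: measurableI.
Qed.

End HausdorffOuterMeasure.

(** * Finiteness and positivity of the area of the sphere *)

Section SphereCover.
Context {R : realType}.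

(** The tool for upper bounds: covers are sequences, so a finite family is
completed by empty sets, which have diameter 0. *)
Lemma hausdorff_content_finite_cover (n s : nat) (T : finType)
    (U : T -> set 'rV[R]_n) (A : set 'rV[R]_n) (r delta : R) :
  0 <= r -> r <= delta -> A `<=` \bigcup_t U t ->
  (forall t, (diam (U t) <= r%:E)%E) ->
  (hausdorff_content s.+1 delta A <= (#|T|%:R * r ^+ s.+1)%:E)%E.
Proof.
move=> r0 rd AU Ur.
pose F k : set 'rV[R]_n :=
  if insub k is Some i then U (@enum_val T predT i) else set0.
have FE (i : 'I_#|T|) : F i = U (enum_val i).
  by rewrite /F valK.
have F0 k : (#|T| <= k)%N -> F k = set0.
  by move=> Tk; rewrite /F insubF// ltnNge Tk.
apply: (@le_trans _ _ (\sum_(0 <= k <oo) diam (F k) ^+ s.+1)%E).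
  apply: ereal_inf_lbound; exists F => //; split.
    move=> x /AU[t _ Ux]; exists (enum_rank t) => //.
    by rewrite FE enum_rankK.
  move=> k; have [kT|kT] := ltnP k #|T|.
    by rewrite (FE (Ordinal kT)) (le_trans (Ur _)).
  by rewrite F0// diam0 lee_fin (le_trans r0).
rewrite (nneseries_split _ #|T|); last first.
  by move=> k _; rewrite expe_ge0// diam_ge0.
rewrite add0n [X in (_ + X)%E]eseries0 ?adde0; last first.
  by move=> k Tk _; rewrite F0// diam0 expeS mul0e.
rewrite big_mkord; apply: (@le_trans _ _ (\sum_(i < #|T|) (r ^+ s.+1)%:E)%E).
  apply: lee_sum => i _; rewrite EFin_expe FE; apply: lee_expe => //.
  exact: diam_ge0.
by rewrite sumEFin sumr_const card_ord mulr_natl.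
Qed.

Variable m : nat.
Local Notation n := m.+1.

(** The cell of index [(i, b, g)]: the [i]-th coordinate has the sign given by [b]
and dominates the others in absolute value, while the other coordinates, once
shifted from [-1, 1] to [0, 2], lie in the cube of mesh 1 / N given by [g]. *)
Definition sphere_cell (N : nat)
    (c : 'I_n * bool * {ffun 'I_m -> 'I_N.*2.+1}) : set 'rV[R]_n :=
  [set x | [/\ sphere x,
    forall j, `|x ord0 j| <= (-1) ^+ c.1.2 * x ord0 c.1.1 &
    forall j, (c.2 j)%:R <= N%:R * (x ord0 (lift c.1.1 j) + 1) <= (c.2 j).+1%:R]].

Lemma sphere_cover (N : nat) : (0 < N)%N ->
  @sphere R n `<=` \bigcup_c @sphere_cell N c.
Proof.
move=> N0 x Sx.
pose i := [arg max_(i > ord0) `|x ord0 i|]%O.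
have imax j : `|x ord0 j| <= `|x ord0 i|.
  by rewrite /i; case: arg_maxP => // k _; exact.
exists (i, x ord0 i < 0,
  [ffun j => inord (Num.truncn (N%:R * (x ord0 (lift i j) + 1)))]) => //.
split => //= [j|j].
  rewrite (le_trans (imax j))//; case: ltP => xi0.
    by rewrite expr1 mulN1r ltr0_norm.
  by rewrite expr0 mul1r ger0_norm.
have /ler_normlP[xj1 xj2] := sphere_coord_le1 (lift i j) Sx.
have y0 : 0 <= N%:R * (x ord0 (lift i j) + 1).
  by rewrite mulr_ge0// -lerBlDr sub0r lerNl.
rewrite ffunE inordK.
  by have /andP[-> /ltW ->] := truncn_itv y0.
rewrite ltnS -(ler_nat R) (le_trans (y := N%:R * (x ord0 (lift i j) + 1)))//.
  by rewrite truncn_le.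
by rewrite -muln2 natrM ler_wpM2l//; lra.
Qed.

(** The coordinates other than the [i]-th vary by at most 1 / N.  As for the
[i]-th, x_i^2 - y_i^2 is the opposite of the same difference for the other
coordinates, hence O(1 / N), while |x_i + y_i| >= 2 / n because x_i and y_i have
the same sign and are dominant. *)
Lemma sphere_cell_diam N c : (0 < N)%N ->
  (diam (@sphere_cell N c) <= (n%:R ^+ 3 / N%:R)%:E)%E.
Proof.
case: c => -[i b] g N0.
have NR : 0 < N%:R :> R by rewrite ltr0n.
apply: diam_le; first by rewrite lee_fin divr_ge0// exprn_ge0.
move=> x y [Sx /= xi xg] [Sy /= yi yg].
rewrite lee_fin exprS -mulrA; apply: enorm_le_coord.
  by rewrite divr_ge0// sqr_ge0.
have close j : `|x ord0 (lift i j) - y ord0 (lift i j)| <= N%:R^-1.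
  have /andP[x1 x2] := xg j; have /andP[y1 y2] := yg j.
  rewrite -[leRHS]mul1r ler_pdivlMr// -[X in _ * X]ger0_norm// -normrM.
  rewrite -natr1 in x2 y2.
  by rewrite ler_norml; apply/andP; split; nra.
set sg := (-1) ^+ b in xi yi.
have sg2 : sg ^+ 2 = 1 by rewrite /sg sqrr_sign.
(* The dominant coordinate is at least 1 / sqrt n, hence at least 1 / n. *)
have large (z : 'rV[R]_n) : sphere z ->
    (forall j, `|z ord0 j| <= sg * z ord0 i) -> 1 <= n%:R * (sg * z ord0 i).
  move=> Sz zi; have zi0 : 0 <= sg * z ord0 i by exact: le_trans (zi i).
  suff : 1 ^+ 2 <= (n%:R * (sg * z ord0 i)) ^+ 2.
    have nz0 : 0 <= n%:R * (sg * z ord0 i) by exact: mulr_ge0.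
    by rewrite (@ler_pXn2r _ 2)// nnegrE.
  rewrite expr1n -[leLHS](sphere_sum_sqr Sz).
  apply: (@le_trans _ _ (\sum_(j < n) (sg * z ord0 i) ^+ 2)).
    apply: ler_sum => j _; rewrite -[leLHS]real_normK ?num_real//.
    by rewrite lerXn2r ?nnegrE.
  rewrite sumr_const card_ord -[leLHS]mulr_natl [leRHS]exprMn ler_wpM2r ?sqr_ge0//.
  by rewrite -natrX ler_nat leq_pmulr.
have xl := large x Sx xi; have yl := large y Sy yi.
have n1 : 1 <= n%:R :> R by rewrite ler1n.
have N1 : 0 <= N%:R^-1 :> R by rewrite invr_ge0.
move=> j; rewrite !mxE; case: (unliftP i j) => [k ->|->].
  by rewrite (le_trans (close k))// ler_peMl// exprn_ege1.
have sq : `|x ord0 i ^+ 2 - y ord0 i ^+ 2| <= m%:R * (2 * N%:R^-1).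
  have : \sum_k x ord0 k ^+ 2 = \sum_k y ord0 k ^+ 2.
    by rewrite !sphere_sum_sqr.
  rewrite !(bigD1_ord i)//= => xy.
  have -> : x ord0 i ^+ 2 - y ord0 i ^+ 2 =
    \sum_(k < m) (y ord0 (lift i k) ^+ 2 - x ord0 (lift i k) ^+ 2).
    by apply/eqP; rewrite sumrB subr_eq addrAC eq_sym subr_eq addrC -xy.
  apply: le_trans (ler_norm_sum _ _ _) _.
  apply: (@le_trans _ _ (\sum_(k < m) (2 * N%:R^-1))); last first.
    by rewrite sumr_const card_ord [leRHS]mulr_natl.
  apply: ler_sum => k _; rewrite subr_sqr normrM mulrC ler_pM//; last first.
    by rewrite distrC.
  rewrite (le_trans (ler_normD _ _))// -[2]/(1 + 1).
  by rewrite lerD// sphere_coord_le1.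
have : `|x ord0 i - y ord0 i| * 2 <= n%:R * (m%:R * (2 * N%:R^-1)).
  apply: (@le_trans _ _
    (`|x ord0 i - y ord0 i| * (n%:R * (sg * (x ord0 i + y ord0 i))))).
    by rewrite ler_wpM2l// mulrDr mulrDr; lra.
  rewrite mulrCA ler_wpM2l//; apply: le_trans sq.
  rewrite subr_sqr normrM ler_wpM2l// (le_trans (ler_norm _))// normrM.
  by rewrite /sg normrX normrN1 expr1n mul1r.
have : n%:R * (m%:R * N%:R^-1) <= n%:R ^+ 2 * N%:R^-1 :> R.
  by rewrite mulrA expr2 ler_wpM2r// ler_wpM2l// ler_nat.
by rewrite (mulrCA _ 2) (mulrCA _ 2); lra.
Qed.

End SphereCover.

(** With N cells per unit length the cover has 2 n (2 N + 1)^(n-1) cells of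
diameter at most n^3 / N, and the powers of N compensate. *)
Lemma hausdorff_sphere_bound (R : realType) (s : nat) :
  (hausdorff s.+1 (@sphere R s.+2) <=
    ((s.+2 * 2)%:R * (3 * s.+2%:R ^+ 3) ^+ s.+1)%:E)%E.
Proof.
apply: ge_ereal_sup => _ [d /= d0 <-].
pose r : R := s.+2%:R ^+ 3.
have r0 : 0 < r by rewrite exprn_gt0.
pose N := (Num.truncn (r / d)).+1.
have NR : 0 < N%:R :> R by rewrite ltr0n.
have rN : r / N%:R <= d.
  by rewrite ler_pdivrMr// mulrC -ler_pdivrMr// ltW// truncnS_gt.
apply: (@le_trans _ _ (#|{: 'I_s.+2 * bool * {ffun 'I_s.+1 -> 'I_N.*2.+1}}|%:R
    * (r / N%:R) ^+ s.+1)%:E).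
  apply: (@hausdorff_content_finite_cover _ _ _ _ (@sphere_cell R s.+1 N)) => //.
  - by rewrite divr_ge0// ltW.
  - exact: sphere_cover.
  - by move=> c; exact: sphere_cell_diam.
rewrite lee_fin !card_prod card_ffun !card_ord card_bool.
rewrite natrM -mulrA ler_wpM2l// natrX -exprMn.
have rN0 : 0 <= r / N%:R by rewrite divr_ge0// ltW.
rewrite lerXn2r ?nnegrE ?mulr_ge0 ?(ltW r0)//.
rewrite mulrA ler_pdivrMr// mulrAC ler_wpM2r ?(ltW r0)//.
by rewrite -natrM ler_nat; lia.
Qed.

Section SphereLowerBound.
Context {R : realType}.
Variable m : nat.
Local Notation n := m.+1.

Lemma card_ord_near (N t a : nat) :
  (#|[pred i : 'I_N | (a <= i + t) && (i <= a + t)]| <= t.*2.+1)%N.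
Proof.
pose h (i : 'I_N) : 'I_t.*2.+1 := inord (i + t - a).
rewrite -[leqRHS]card_ord; apply: (@leq_card_in _ _ h).
move=> i j; rewrite !inE => /andP[i1 i2] /andP[j1 j2].
move=> /(congr1 val) /=; rewrite !inordK; [|lia..] => ij.
by apply/val_inj => /=; lia.
Qed.

(** The point of the upper half sphere above the grid point g / (N n); the
factor 1 / n keeps the whole grid inside the unit ball. *)
Definition grid_point (N : nat) (g : {ffun 'I_m -> 'I_N}) : 'rV[R]_n :=
  \row_i (if unlift ord0 i is Some j then (g j)%:R / (N * n)%:R
          else Num.sqrt (1 - \sum_j ((g j)%:R / (N * n)%:R) ^+ 2)).

Lemma grid_point_lift N (g : {ffun 'I_m -> 'I_N}) j :
  grid_point g ord0 (lift ord0 j) = (g j)%:R / (N * n)%:R.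
Proof. by rewrite mxE liftK. Qed.

Lemma grid_point_sphere N (g : {ffun 'I_m -> 'I_N}) : (0 < N)%N ->
  sphere (grid_point g).
Proof.
move=> N0; rewrite /sphere /= /enorm big_ord_recl mxE unlift_none.
have NR : 0 < N%:R :> R by rewrite ltr0n.
rewrite sqr_sqrtr.
  under [X in _ + X]eq_bigr do rewrite grid_point_lift.
  by rewrite subrK sqrtr1.
rewrite subr_ge0; apply: (@le_trans _ _ (\sum_(j < m) (n%:R^-1))).
  apply: ler_sum => j _; apply: (@le_trans _ _ (n%:R^-1 ^+ 2)).
    rewrite lerXn2r ?nnegrE// ?divr_ge0//.
    rewrite natrM invfM mulrA -[leRHS]mul1r ler_wpM2r// ler_pdivrMr// mul1r.
    by rewrite ler_nat ltnW.
  by rewrite expr2 ler_piMl// invf_le1// ler1n.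
by rewrite sumr_const card_ord -[leLHS]mulr_natl ler_pdivrMr// mul1r ler_nat.
Qed.

(** Count the N^m grid points of the sphere.  Two of them lying in [O k] differ by
at most N n D_k in each integer coordinate, so [O k] contains at most
(2 N n D_k + 1)^m of them, which is at most (3 N n D_k)^m as soon as
N D_k >= 1. *)
Lemma sphere_cover_lower (K : nat) (O : 'I_K -> set 'rV[R]_n) (D : 'I_K -> R) :
  (forall k, 0 < D k) ->
  (forall k x y j, O k x -> O k y -> `|x ord0 j - y ord0 j| <= D k) ->
  @sphere R n `<=` \bigcup_k O k ->
  1 <= (3 * n%:R) ^+ m * \sum_k D k ^+ m.
Proof.
move=> D0 OD SO.
(* There are finitely many D_k, so one N makes all the products N D_k large. *)
pose N := (\max_k Num.truncn ((D k)^-1)).+1.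
have N0 : (0 < N)%N by [].
have NR : 0 < N%:R :> R by rewrite ltr0n.
have ND k : 1 <= N%:R * D k.
  rewrite -ler_pdivrMr// div1r ltW//.
  apply: (lt_le_trans (truncnS_gt _)); rewrite ler_nat ltnS.
  exact: leq_bigmax.
pose G k := [pred g : {ffun 'I_m -> 'I_N} | `[< O k (grid_point g) >]].
have cardG k : #|G k|%:R <= (3 * n%:R * N%:R * D k) ^+ m.
  have [g0 Gg0|G0] := pickP (G k); last by rewrite (eq_card0 G0) exprn_ge0//
    -!mulrA !mulr_ge0// ltW.
  pose t := Num.truncn ((N * n)%:R * D k).
  have r1 : 1 <= (N * n)%:R * D k.
    rewrite natrM -mulrA mulrCA; apply: (le_trans (ND k)).
    by rewrite ler_peMl ?ler1n// (le_trans _ (ND k)).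
  have tr : t%:R <= (N * n)%:R * D k by rewrite truncn_le (le_trans _ r1).
  have sub : {subset G k <= family (fun j =>
      [pred i : 'I_N | (g0 j <= i + t) && (i <= g0 j + t)]%N)}.
    move=> g Gg; apply/familyP => j; rewrite inE.
    have := OD k _ _ (lift ord0 j) (asboolW Gg) (asboolW Gg0).
    rewrite !grid_point_lift -mulrBl normrM (ger0_norm (_ : 0 <= _^-1))//.
    rewrite ler_pdivrMr ?ltr0n ?muln_gt0//; rewrite mulrC.
    move=> h; have {}h : `|(g j)%:R - (g0 j)%:R| < t.+1%:R :> R.
      exact: le_lt_trans h (truncnS_gt _).
    move: h; rewrite ltr_norml => /andP[h1 h2].
    have h1' : (g0 j)%:R < (g j + t.+1)%:R :> R by rewrite natrD; lra.
    have h2' : (g j)%:R < (g0 j + t.+1)%:R :> R by rewrite natrD; lra.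
    by move: h1' h2'; rewrite !ltr_nat !addnS !ltnS => -> ->.
  have := subset_leq_card (introT fintype.subsetP sub); rewrite card_family => le1.
  apply: (@le_trans _ _ ((t.*2.+1 ^ m)%:R)).
    rewrite ler_nat (leq_trans le1)// foldrE big_map.
    rewrite -[X in (_ <= _ ^ X)%N](card_ord m) -prod_nat_const big_enum/=.
    by apply: leq_prod => j _; exact: card_ord_near.
  have -> : 3 * n%:R * N%:R * D k = 3 * ((N * n)%:R * D k).
    by rewrite natrM; ring.
  rewrite natrX lerXn2r ?nnegrE//; first by rewrite mulr_ge0// (le_trans _ r1).
  by rewrite -natr1 -muln2 natrM; lra.
have : (N ^ m)%:R <= \sum_k (3 * n%:R * N%:R * D k) ^+ m :> R.
  apply: (@le_trans _ _ (\sum_k #|G k|%:R)); last exact: ler_sum.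
  rewrite -natr_sum ler_nat -[X in (X ^ _)%N]card_ord.
  rewrite -[X in (_ ^ X)%N]card_ord -card_ffun -sum1_card.
  (* Double counting of the pairs (g, k) with the grid point g in O k. *)
  apply: (@leq_trans (\sum_(g : {ffun 'I_m -> 'I_N}) \sum_(k | G k g) 1)).
    apply: leq_sum => g _; have [k _ Okg] := SO _ (grid_point_sphere g N0).
    by rewrite (bigD1 k)//=; apply/asboolP.
  rewrite (exchange_big_dep predT)//=; apply: leq_sum => k _.
  by rewrite sum1_card.
rewrite -(ler_pM2l (_ : 0 < N%:R ^+ m)) ?exprn_gt0// mulr1 natrX.
move=> /le_trans; apply; rewrite mulrA mulr_sumr; apply: ler_sum => k _.
by rewrite -!exprMn (mulrC N%:R).
Qed.

End SphereLowerBound.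

Lemma exprD_le (R : realType) (a b : R) k : 0 <= a -> 0 <= b ->
  (a + b) ^+ k <= 2 ^+ k * (a ^+ k + b ^+ k).
Proof.
move=> a0 b0; wlog ab : a b a0 b0 / a <= b.
  move=> H; have [/H->//|/ltW/H] := leP a b.
  by rewrite addrC [X in _ <= _ * X]addrC; apply.
apply: (@le_trans _ _ ((2 * b) ^+ k)).
  by rewrite lerXn2r ?nnegrE ?addr_ge0 ?mulr_ge0//; lra.
by rewrite exprMn ler_wpM2l ?exprn_ge0// lerDr exprn_ge0.
Qed.

Lemma sum_half_pow_le1 (R : realType) K :
  \sum_(k < K) (2^-1 : R) ^+ k.+1 <= 1.
Proof.
suff -> : \sum_(k < K) (2^-1 : R) ^+ k.+1 = 1 - 2^-1 ^+ K.
  by rewrite gerBl exprn_ge0.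
elim: K => [|K IH]; first by rewrite big_ord0 expr0 subrr.
by rewrite big_ord_recr/= IH exprS; lra.
Qed.

(** The k-th set of a cover is enlarged to an open set by [h k / 2], where the
total of the enlargements [h k] is at most half of the constant [c] that
[sphere_cover_lower] provides; what is left for the diameters of the original
sets is at least [c / 2]. *)
Lemma hausdorff_sphere_gt0 (R : realType) (s : nat) :
  (0 < hausdorff s.+1 (@sphere R s.+2))%E.
Proof.
pose c : R := ((6 * s.+2%:R) ^+ s.+1)^-1.
have c0 : 0 < c by rewrite invr_gt0 exprn_gt0// mulr_gt0.
have c1 : c <= 1.
  rewrite invf_le1 ?exprn_gt0 ?mulr_gt0// exprn_ege1//.
  by rewrite -natrM ler1n.
apply: (@lt_le_trans _ _ (c / 2)%:E); first by rewrite lte_fin divr_gt0.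
apply: le_trans (content_le_hausdorff s.+1 _ (ltr01 : 0 < (1:R))).
apply: le_ereal_inf_tmp => _ [U [SU Ud] <-].
have dU k : diam (U k) \is a fin_num.
  by rewrite ge0_fin_numE ?diam_ge0// (le_lt_trans (Ud k))// ltry.
pose d k : R := fine (diam (U k)).
have dE k : diam (U k) = (d k)%:E by rewrite fineK.
have d0 k : 0 <= d k by rewrite fine_ge0// diam_ge0.
(* h k <= 1 makes its power of exponent s.+1 at most h k, which is summable. *)
pose h k : R := c / 2 * 2^-1 ^+ k.+1.
have h0 k : 0 < h k by rewrite mulr_gt0 ?exprn_gt0// divr_gt0.
have h1 k : h k <= 1.
  rewrite mulr_ile1 ?exprn_ge0 ?exprn_ile1//; first by rewrite divr_ge0// ltW.
  - by lra.
  - by lra.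
pose O k := \bigcup_(u in U k) ball u (h k / 2).
have := @sphere_compact R s.+2; rewrite compact_cover.
move=> /(_ _ setT O)[].
- by move=> k _; apply: bigcup_open => u _; apply: ball_open; rewrite divr_gt0.
- move=> x /SU[k _ Ux]; exists k => //; exists x => //.
  by apply: ballxx; rewrite divr_gt0.
move=> F _ SF.
pose K := (\max_(k <- finmap.enum_fset F) k).+1.
have SO : @sphere R s.+2 `<=` \bigcup_(k : 'I_K) O k.
  move=> x /SF[k /= kF Ox].
  have kK : (k < K)%N by rewrite ltnS; exact: leq_bigmax_seq.
  by exists (Ordinal kK).
have := @sphere_cover_lower R s.+1 K (fun k => O k) (fun k => d k + h k) _ _ SO.
have D0 (k : 'I_K) : 0 < d k + h k by rewrite ltr_wpDl.
have OD (k : 'I_K) (x y : 'rV[R]_s.+2) j :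
    O k x -> O k y -> `|x ord0 j - y ord0 j| <= d k + h k.
  move=> [u Uu [_ /(_ ord0 j) ux]] [v Uv [_ /(_ ord0 j) vy]].
  have := enorm_le_diam Uu Uv; rewrite dE lee_fin => uv.
  have := le_trans (coord_le_enorm _ j) uv; rewrite !mxE.
  move: ux vy; rewrite /ball/= !ltr_norml ler_norml => /andP[a1 a2] /andP[b1 b2].
  by move=> /andP[e1 e2]; rewrite ler_norml; apply/andP; split; lra.
move=> /(_ D0 OD) lower.
apply: (@le_trans _ _ (\sum_(0 <= k < K) diam (U k) ^+ s.+1)%E); last first.
  by apply: nneseries_lim_ge => k _ _; rewrite expe_ge0// diam_ge0.
under eq_bigr do rewrite dE -EFin_expe.
rewrite sumEFin lee_fin big_mkord.
have {}lower : 1 <= (3 * s.+2%:R) ^+ s.+1 *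
    (2 ^+ s.+1 * (\sum_(k < K) d k ^+ s.+1 + c / 2)).
  apply: (le_trans lower); rewrite ler_wpM2l ?exprn_ge0 ?mulr_ge0//.
  apply: (@le_trans _ _ (\sum_(k < K) 2 ^+ s.+1 * (d k ^+ s.+1 + h k))).
    apply: ler_sum => k _; apply: (le_trans (exprD_le _ _ _)) => //.
      exact: ltW.
    rewrite ler_wpM2l ?exprn_ge0// lerD2l exprS ler_piMr ?(ltW (h0 _))//.
    by rewrite exprn_ile1// ltW.
  rewrite -mulr_sumr ler_wpM2l ?exprn_ge0// big_split/= lerD2l.
  by rewrite -mulr_sumr ler_piMr ?sum_half_pow_le1// divr_ge0// ltW.
move: lower; rewrite mulrA -exprMn (_ : 3 * s.+2%:R * 2 = 6 * s.+2%:R); last by lra.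
rewrite -[(6 * _) ^+ _]invrK -/c mulrC ler_pdivlMr// mul1r; lra.
Qed.

(** * The energy as a function of the second moments *)

Section SphereIntegrals.
Context {R : realType} {n : nat}.
Implicit Types (f g : 'rV[R]_n -> R) (v w : 'rV[R]_n).
Local Notation S := (@sphere R n).

Lemma borel_open (U : set 'rV[R]_n) : open U -> measurable (U : set (borelRn R n)).
Proof. exact: sub_sigma_algebra. Qed.

Lemma borel_closed (C : set 'rV[R]_n) :
  closed C -> measurable (C : set (borelRn R n)).
Proof.
by move=> /closed_openC/borel_open/measurableC; rewrite setCK.
Qed.

Lemma measurable_sphere : measurable (S : set (borelRn R n)).
Proof. by apply: borel_closed; exact: sphere_closed. Qed.

Lemma continuous_borel f : continuous f ->
  measurable_fun setT (f : borelRn R n -> R).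
Proof.
move=> /continuousP cf; apply: (measurability _ (RGenOpens.measurableE R)).
move=> _ [_ [a [b ->]] <-]; rewrite setTI.
by apply: borel_open; exact/cf/interval_open.
Qed.

(** The sphere is compact, so a continuous function is bounded on it. *)
Lemma sphere_integrable (mu : probability (borelRn R n) R) f : continuous f ->
  mu.-integrable S (EFin \o (f : borelRn R n -> R)).
Proof.
move=> cf; apply: measurable_bounded_integrable.
- exact: measurable_sphere.
- by apply: le_lt_trans (probability_le1 mu measurable_sphere) _; rewrite ltry.
- by apply: measurable_funTS; exact: continuous_borel.
have : compact (f @` S).
  apply: continuous_compact; last exact: sphere_compact.
  exact: continuous_subspaceT.
move=> /compact_bounded[M [Mr fM]]; exists M; split=> // x Mx v Sv.
by apply: fM Mx _ _; exists v.
Qed.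

Variable mu : probability (borelRn R n) R.

Definition mean f : R := \int[mu]_(v in S) f v.

Lemma integral_mean f : continuous f -> (\int[mu]_(v in S) (f v)%:E = (mean f)%:E)%E.
Proof.
move=> cf; rewrite /mean /Rintegral fineK//.
by apply: integrable_fin_num; [exact: measurable_sphere|exact: sphere_integrable].
Qed.

Lemma eq_mean f g : (forall v, sphere v -> f v = g v) -> mean f = mean g.
Proof. by move=> fg; apply: eq_Rintegral => v; rewrite inE => /fg. Qed.

Lemma meanD f g : continuous f -> continuous g ->
  mean (fun v => f v + g v) = mean f + mean g.
Proof.
move=> cf cg; apply: RintegralD; first exact: measurable_sphere.
- exact: sphere_integrable.
- exact: sphere_integrable.
Qed.

Lemma meanZ (a : R) f : continuous f -> mean (fun v => a * f v) = a * mean f.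
Proof.
move=> cf; apply: RintegralZl; first exact: measurable_sphere.
exact: sphere_integrable.
Qed.

Lemma mean_sum (I : Type) (r : seq I) (F : I -> 'rV[R]_n -> R) :
  (forall i, continuous (F i)) ->
  mean (fun v => \sum_(i <- r) F i v) = \sum_(i <- r) mean (F i).
Proof.
move=> cF; elim: r => [|i r IH].
  rewrite big_nil -[RHS](mul0r (mean (fun=> 0))) -meanZ; last exact: cst_continuous.
  by apply: eq_mean => v _; rewrite big_nil mul0r.
rewrite big_cons -IH -meanD//; last exact: continuous_sum.
by apply: eq_mean => v _; rewrite big_cons.
Qed.

Hypothesis mu_sphere : mu S = 1%E.

Lemma mean_cst (a : R) : mean (fun=> a) = a.
Proof.
rewrite /mean Rintegral_cst; last exact: measurable_sphere.
by rewrite [X in fine X]mu_sphere mulr1.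
Qed.

Definition coord i v : R := v ord0 i.

Lemma continuous_coord i : continuous (coord i).
Proof. exact: coord_continuous. Qed.

Lemma continuous_coord2 i j : continuous (fun v => v ord0 i * v ord0 j).
Proof. by move=> v; apply: continuousM; exact: continuous_coord. Qed.

Lemma barycenterE i : barycenter mu ord0 i = mean (coord i).
Proof. by rewrite mxE. Qed.

Definition moment i j : R := mean (fun v => v ord0 i * v ord0 j).

Lemma isotropicP : isotropic mu <->
  forall i j, moment i j = n%:R^-1 * (i == j)%:R.
Proof.
split=> iso i j; have := iso i j.
  by rewrite (integral_mean (@continuous_coord2 i j)) => -[].
by rewrite (integral_mean (@continuous_coord2 i j)) => <-.
Qed.

Lemma trace_moment : \sum_i moment i i = 1.
Proof.
rewrite /moment -mean_sum; last by move=> i; exact: continuous_coord2.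
rewrite -[RHS](mean_cst 1); apply: eq_mean => v Sv.
by rewrite -[RHS](sphere_sum_sqr Sv); apply: eq_bigr => i _; rewrite expr2.
Qed.

(** Both integrations that lead from the kernel |v - w|^4 to the energy are applied
to functions of this shape. *)
Definition quadratic (a b c : R) (x : 'I_n -> R) (y : 'I_n -> 'I_n -> R) v : R :=
  a + (b * (\sum_i x i * v ord0 i)
       + c * (\sum_i \sum_j y i j * (v ord0 i * v ord0 j))).

Lemma continuous_scale (a : R) f : continuous f -> continuous (fun v => a * f v).
Proof.
by move=> cf v; apply: continuousM; [exact: cst_continuous|exact: cf].
Qed.

Lemma continuous_add f g : continuous f -> continuous g ->
  continuous (fun v => f v + g v).
Proof. by move=> cf cg v; apply: continuousD; [exact: cf|exact: cg]. Qed.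

Let cL x : continuous (fun v : 'rV[R]_n => \sum_i x i * v ord0 i).
Proof.
by apply: continuous_sum => i; apply: continuous_scale; exact: continuous_coord.
Qed.

Let cQi (y : 'I_n -> 'I_n -> R) i :
  continuous (fun v : 'rV[R]_n => \sum_j y i j * (v ord0 i * v ord0 j)).
Proof.
apply: continuous_sum => j; apply: continuous_scale; exact: continuous_coord2.
Qed.

Let cQ (y : 'I_n -> 'I_n -> R) :
  continuous (fun v : 'rV[R]_n => \sum_i \sum_j y i j * (v ord0 i * v ord0 j)).
Proof. by apply: continuous_sum => i; exact: cQi. Qed.

Lemma continuous_quadratic a b c x y : continuous (quadratic a b c x y).
Proof.
apply: continuous_add; first exact: cst_continuous.
by apply: continuous_add; apply: continuous_scale; [exact: cL|exact: cQ].
Qed.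

Lemma mean_quadratic a b c x y : mean (quadratic a b c x y) =
  a + (b * (\sum_i x i * barycenter mu ord0 i)
       + c * (\sum_i \sum_j y i j * moment i j)).
Proof.
rewrite meanD; first last.
- by apply: continuous_add; apply: continuous_scale; [exact: cL|exact: cQ].
- exact: cst_continuous.
rewrite mean_cst meanD; [|by apply: continuous_scale; exact: cL|by apply: continuous_scale; exact: cQ].
rewrite !meanZ; [|exact: cQ|exact: cL].
congr (a + (b * _ + c * _)).
  rewrite mean_sum; last by move=> i; apply: continuous_scale; exact: continuous_coord.
  by apply: eq_bigr => i _; rewrite meanZ ?barycenterE//; exact: continuous_coord.
rewrite mean_sum; last exact: cQi.
apply: eq_bigr => i _; rewrite mean_sum; last first.
  by move=> j; apply: continuous_scale; exact: continuous_coord2.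
by apply: eq_bigr => j _; rewrite meanZ//; exact: continuous_coord2.
Qed.

Lemma sphere_dist4 v w : sphere v -> sphere w ->
  enorm (v - w) ^+ 4 =
  quadratic 4 (- 8) 4 (fun i => w ord0 i) (fun i j => w ord0 i * w ord0 j) v.
Proof.
move=> Sv Sw; rewrite -[4%N]/(2 * 2)%N exprM sqr_enormB// dotC /quadratic.
rewrite -/(dot w v).
have -> : \sum_i \sum_j w ord0 i * w ord0 j * (v ord0 i * v ord0 j)
    = dot w v ^+ 2.
  rewrite expr2 /dot big_distrlr/=.
  by apply: eq_bigr => i _; apply: eq_bigr => j _; ring.
by ring.
Qed.

Lemma J4_moments : barycenter mu = 0 ->
  J4 mu = (4 + 4 * \sum_i \sum_j moment i j ^+ 2)%:E.
Proof.
move=> b0; rewrite /J4.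
pose G w := quadratic 4 (- 8) 4 (fun=> 0) moment w.
rewrite (eq_integral (fun w : borelRn R n => (G w)%:E)); last first.
  move=> w; rewrite inE => Sw.
  rewrite (eq_integral (fun v : borelRn R n => (quadratic 4 (- 8) 4 (fun i => w ord0 i)
    (fun i j => w ord0 i * w ord0 j) v)%:E)); last first.
    by move=> v; rewrite inE => Sv; rewrite sphere_dist4.
  rewrite integral_mean; last exact: continuous_quadratic.
  rewrite mean_quadratic /G /quadratic b0; congr (_ + (_ * _ + _ * _))%:E.
    by apply: eq_bigr => i _; rewrite mxE mul0r mulr0.
  by apply: eq_bigr => i _; apply: eq_bigr => j _; rewrite mulrC.
rewrite integral_mean; last exact: continuous_quadratic.
rewrite mean_quadratic; congr (_ + _)%:E.
rewrite big1; last by move=> i _; rewrite mul0r.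
by rewrite mulr0 add0r; under eq_bigr do under eq_bigr do rewrite -expr2.
Qed.

Hypothesis n_gt0 : (0 < n)%N.

(** The cross term is - (2 / n) * trace, and the trace is 1: this is Pythagoras
for the orthogonal decomposition of a matrix of trace 1 into I / n and a
traceless part. *)
Lemma moment_defect :
  \sum_i \sum_j (moment i j - n%:R^-1 * (i == j)%:R) ^+ 2 =
  \sum_i \sum_j moment i j ^+ 2 - n%:R^-1.
Proof.
have nR : n%:R != 0 :> R by rewrite pnatr_eq0 -lt0n.
transitivity (\sum_i ((\sum_j moment i j ^+ 2)
    + (- (2 * n%:R^-1) * moment i i + n%:R^-1 ^+ 2))).
  apply: eq_bigr => i _.
  transitivity (\sum_j (moment i j ^+ 2
      + (i == j)%:R * (- (2 * n%:R^-1) * moment i j + n%:R^-1 ^+ 2))).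
    by apply: eq_bigr => j _; case: eqVneq => _ /=; ring.
  rewrite big_split/=; congr (_ + _); rewrite (bigD1 i)//= eqxx mul1r.
  rewrite big1 ?addr0// => j; rewrite eq_sym => /negbTE ->.
  by rewrite mul0r.
rewrite big_split/=; congr (_ + _).
rewrite big_split/= -mulr_sumr trace_moment sumr_const card_ord -[X in _ + X]mulr_natl.
by field.
Qed.

Lemma J4_defect : barycenter mu = 0 -> J4 mu =
  (4 + 4 / n%:R
   + 4 * \sum_i \sum_j (moment i j - n%:R^-1 * (i == j)%:R) ^+ 2)%:E.
Proof.
by move=> /J4_moments ->; rewrite moment_defect; congr EFin; ring.
Qed.

End SphereIntegrals.

Lemma J4_ge (R : realType) (n : nat) (mu : probability (borelRn R n) R) :
  (0 < n)%N -> P0 mu -> ((4 + 4 / n%:R)%:E <= J4 mu)%E.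
Proof.
move=> n0 [muS b0]; rewrite J4_defect// lee_fin lerDl mulr_ge0//.
by rewrite sumr_ge0// => i _; rewrite sumr_ge0// => j _; rewrite sqr_ge0.
Qed.

Lemma J4_eq_isotropic (R : realType) (n : nat) (mu : probability (borelRn R n) R) :
  (0 < n)%N -> P0 mu -> J4 mu = (4 + 4 / n%:R)%:E <-> isotropic mu.
Proof.
move=> n0 [muS b0]; rewrite J4_defect// isotropicP; split; last first.
  move=> iso; rewrite big1 ?mulr0 ?addr0// => i _.
  by rewrite big1// => j _; rewrite iso subrr expr0n.
move=> [] /eqP; rewrite -subr_eq0 addrAC subrr add0r mulf_eq0 pnatr_eq0/=.
have ge0 i : 0 <= \sum_j (moment mu i j - n%:R^-1 * (i == j)%:R) ^+ 2.
  by rewrite sumr_ge0// => j _; rewrite sqr_ge0.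
rewrite psumr_eq0// => /allP H i j.
have := H i (mem_index_enum _); rewrite /= psumr_eq0; last by move=> *; rewrite sqr_ge0.
by move=> /allP/(_ j (mem_index_enum _)); rewrite /= sqrf_eq0 subr_eq0 => /eqP.
Qed.

(** * Regular simplices *)

Section Gram.
Context {R : realType} {n : nat}.
Implicit Types w : 'rV[R]_n.

Lemma dot_suml m (x : 'I_m -> R) (V : 'I_m -> 'rV[R]_n) w :
  dot (\sum_k x k *: V k) w = \sum_k x k * dot (V k) w.
Proof.
rewrite /dot; under eq_bigr do rewrite summxE mulr_suml.
rewrite exchange_big; apply: eq_bigr => k _; rewrite mulr_sumr.
by apply: eq_bigr => i _; rewrite mxE mulrA.
Qed.

Variables (V : 'I_n.+1 -> 'rV[R]_n) (c : R).
Hypothesis V_sphere : forall i, dot (V i) (V i) = 1.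
Hypothesis V_dot : forall i j, i != j -> dot (V i) (V j) = c.
Hypothesis c_neq1 : c != 1.

(** Pairing a linear dependency, with coefficients x, with the j-th vector gives
(1 - c) * x_j = - c * (the sum of the x_k), whose right-hand side does not
depend on j.  As c <> 1, all the x_j are equal, and they are not 0. *)
Lemma equiangular_sum0 : \sum_i V i = 0.
Proof.
pose A : 'M[R]_(n.+1, n) := \matrix_(i, j) V i ord0 j.
have kerA : kermx A != 0.
  by rewrite kermx_eq0 /row_free neq_ltn ltnS rank_leq_col.
have [x xA x0] : exists2 x : 'rV[R]_n.+1, x *m A = 0 & x != 0.
  have /rowV0Pn[i ri i0] := kerA.
  by exists i => //; exact/sub_kermxP.
have xV : \sum_k x ord0 k *: V k = 0.
  apply/rowP => j; rewrite summxE [RHS]mxE.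
  transitivity ((x *m A) ord0 j); last by rewrite xA mxE.
  rewrite mxE.
  by apply: eq_bigr => k _; rewrite !mxE.
have xc j : (1 - c) * x ord0 j = - (c * \sum_k x ord0 k).
  have : dot (\sum_k x ord0 k *: V k) (V j) = 0.
    by rewrite xV /dot big1// => i _; rewrite mxE mul0r.
  rewrite dot_suml (bigD1 j)//= V_sphere mulr1.
  rewrite (eq_bigr (fun k => x ord0 k * c)); last by move=> k kj; rewrite V_dot.
  by rewrite -mulr_suml => E; rewrite (bigD1 j)//=; lra.
have xE j : x ord0 j = x ord0 ord0.
  by apply: (@mulfI _ (1 - c)); rewrite ?subr_eq0 1?eq_sym// !xc.
have t0 : x ord0 ord0 != 0.
  apply: contra_neq x0 => t0; apply/rowP => j.
  by rewrite xE t0 mxE.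
apply: (@scalerI _ _ (x ord0 ord0)) => //; rewrite scaler0 -[RHS]xV scaler_sumr.
by apply: eq_bigr => k _; rewrite xE.
Qed.

Lemma equiangular_dot : n%:R * c = - 1.
Proof.
have : dot (\sum_k 1 *: V k) (V ord0) = 0.
  under eq_bigr do rewrite scale1r.
  by rewrite equiangular_sum0 /dot big1// => i _; rewrite mxE mul0r.
rewrite dot_suml big_ord_recl V_sphere (eq_bigr (fun=> c)); last first.
  by move=> k _; rewrite V_dot// mul1r.
by rewrite sumr_const card_ord -mulr_natl; lra.
Qed.

End Gram.

Section Simplex.
Context {R : realType} {n : nat}.
Hypothesis n_gt0 : (0 < n)%N.

Let nR : n%:R != 0 :> R. Proof. by rewrite pnatr_eq0 -lt0n. Qed.

Let a : R := Num.sqrt (1 + n%:R^-1).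
Let t : R := Num.sqrt n%:R^-1.
Let b : R := (t - a) / n%:R.

Let a2 : a ^+ 2 = 1 + n%:R^-1.
Proof. by rewrite sqr_sqrtr// addr_ge0// invr_ge0. Qed.

Let t2 : t ^+ 2 = n%:R^-1.
Proof. by rewrite sqr_sqrtr// invr_ge0. Qed.

(** One vertex is the multiple - t (1, ..., 1) of the diagonal vector; the others
are the a e_k + b (1, ..., 1).  The constants ensure that a + n b = t and
b (a + t) = - 1 / n, from which all the scalar products follow. *)
Definition simplex_vertex (i : 'I_n.+1) : 'rV[R]_n :=
  \row_j (if unlift ord0 i is Some k then a * (j == k)%:R + b else - t).

Lemma dot_simplex_vertex i j :
  dot (simplex_vertex i) (simplex_vertex j) = if i == j then 1 else - n%:R^-1.
Proof.
have anb : a + n%:R * b = t by rewrite /b; field.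
have sumk (k : 'I_n) (y : R) : \sum_l (a * (l == k)%:R + b) * y = t * y.
  rewrite -mulr_suml big_split/= -mulr_sumr sumr_const card_ord.
  rewrite (bigD1 k)//= eqxx big1 => [|l /negbTE->//].
  by rewrite addr0 mulr1 -mulr_natl anb.
rewrite /dot; case: (unliftP ord0 i) => [k ->|->]; last first.
  case: (unliftP ord0 j) => [l ->|->].
    under eq_bigr do rewrite !mxE unlift_none liftK mulrC.
    by rewrite sumk mulrN -expr2 t2.
  under eq_bigr do rewrite !mxE unlift_none mulrNN -expr2 t2.
  by rewrite sumr_const card_ord eqxx -[LHS]mulr_natl divff.
case: (unliftP ord0 j) => [l ->|->]; last first.
  under eq_bigr do rewrite !mxE unlift_none liftK.
  by rewrite sumk mulrN -expr2 t2.
under eq_bigr do rewrite !mxE !liftK mulrDr.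
rewrite big_split/= sumk (bigD1 l)//= eqxx mulr1.
rewrite big1 => [|p /negbTE->]; last by rewrite !mulr0.
rewrite addr0 (inj_eq lift_inj) eq_sym.
have E : b * (a + t) = - n%:R^-1.
  rewrite /b mulrAC; have -> : (t - a) * (a + t) = t ^+ 2 - a ^+ 2 by ring.
  by rewrite t2 a2; field.
by case: eqVneq => _ /=; [rewrite mulr1 mulrDl -expr2 a2|]; lra.
Qed.

Lemma regular_simplex_exists : regular_simplex simplex_vertex.
Proof.
have Sv i : sphere (simplex_vertex i).
  by apply/sphere_dotP; rewrite dot_simplex_vertex eqxx.
split=> //.
  move=> i j ij; apply/eqP; apply: contraT => /negbTE ij'.
  have := dot_simplex_vertex i j; rewrite ij' ij dot_simplex_vertex eqxx.
  by move=> /eqP; rewrite eq_sym lt_eqF// (@lt_trans _ _ 0)// oppr_lt0 invr_gt0 ltr0n.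
exists (Num.sqrt (2 + 2 * n%:R^-1)) => i j ij.
rewrite -[LHS]ger0_norm ?enorm_ge0// -sqrtr_sqr sqr_enormB// dot_simplex_vertex.
by rewrite (negbTE ij) mulrN opprK.
Qed.

Variable v : 'I_n.+1 -> 'rV[R]_n.
Hypothesis v_simplex : regular_simplex v.

Lemma regular_simplex_equiangular :
  \sum_i v i = 0 /\
  forall i j, dot (v i) (v j) = if i == j then 1 else - n%:R^-1.
Proof.
have [Sv injv [l vl]] := v_simplex.
pose c := 1 - l ^+ 2 / 2.
have vv i : dot (v i) (v i) = 1 by exact/sphere_dotP.
have vc i j : i != j -> dot (v i) (v j) = c.
  by move=> /vl ij; have := sqr_enormB (Sv i) (Sv j); rewrite ij /c; lra.
have c1 : c != 1.
  apply/eqP => c1.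
  have : enorm (v ord0 - v ord_max) = 0.
    apply/eqP; rewrite -sqrf_eq0 sqr_enormB// vc ?c1 ?mulr1 ?subrr//.
    by rewrite -val_eqE/= eq_sym -lt0n.
  move=> e0; have : v ord0 = v ord_max.
    apply/rowP => i; apply/eqP; rewrite -subr_eq0 -normr_le0 -e0.
    by have := coord_le_enorm (v ord0 - v ord_max) i; rewrite !mxE.
  by move=> /injv/(congr1 val)/= n0; move: n_gt0; rewrite -n0.
split; first exact: equiangular_sum0 vv vc c1.
move=> i j; case: eqVneq => [->//|/vc ->].
have := equiangular_dot vv vc c1 => nc.
by apply: (mulfI nR); rewrite nc mulrN divff.
Qed.

Let v_sphere i : sphere (v i). Proof. by case: v_simplex. Qed.

Lemma dirac_sphere x : sphere x ->
  \d_(x : borelRn R n) (@sphere R n : set (borelRn R n)) = 1%E :> \bar R.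
Proof. by move=> Sx; rewrite (diracE (T := borelRn R n)) mem_set. Qed.

Lemma mu_sim_sphere : mu_sim v (@sphere R n) = 1%E.
Proof.
rewrite /mu_sim /mscale /= /msum (eq_bigr (fun=> 1%E)); last first.
  by move=> k _; exact: dirac_sphere.
rewrite sumEFin -EFinM; congr EFin.
by rewrite sumr_const card_ord mulVf // pnatr_eq0.
Qed.

(** The formulas for integrals against multiples and sums of measures hold for
nonnegative functions; they extend to [f] because
2 f = (f + 1)^2 - f^2 - 1. *)
Lemma mean_mu_sim (f : 'rV[R]_n -> R) : continuous f ->
  mean (mu_sim v) f = n.+1%:R^-1 * \sum_k f (v k).
Proof.
have ge0 (g : 'rV[R]_n -> R) : continuous g -> (forall x, 0 <= g x) ->
    mean (mu_sim v) g = n.+1%:R^-1 * \sum_k g (v k).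
  move=> cg g0; apply: EFin_inj; rewrite -integral_mean//.
  pose G : borelRn R n -> \bar R := fun x => (g x)%:E.
  have mG : measurable_fun (@sphere R n : set (borelRn R n)) G.
    by apply/measurable_EFinP/measurable_funTS; exact: continuous_borel.
  rewrite ge0_integral_mscale//; [|exact: measurable_sphere|by move=> *; rewrite lee_fin].
  rewrite ge0_integral_measure_sum//; [|exact: measurable_sphere|by move=> *; rewrite lee_fin].
  rewrite EFinM -sumEFin; congr (_ * _)%E; apply: eq_bigr => k _.
  rewrite integral_dirac//; last exact: measurable_sphere.
  by rewrite dirac_sphere// mul1e inord_val.
move=> cf.
have c1 : continuous (fun x => f x + 1).
  by apply: continuous_add => //; exact: cst_continuous.
have sq (g : 'rV[R]_n -> R) : continuous g -> continuous (fun x => g x ^+ 2).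
  by move=> cg x; apply: continuousM; exact: cg.
have : mean (mu_sim v) (fun x => (f x + 1) ^+ 2) =
   mean (mu_sim v) (fun x => f x ^+ 2 + (2 * f x + 1)).
  by apply: eq_mean => x _; ring.
have c2 : continuous (fun x => 2 * f x) by exact: continuous_scale.
have s1 := sq _ c1; have s2 := sq _ cf.
rewrite meanD//; last by apply: continuous_add => //; exact: cst_continuous.
rewrite meanD//; last exact: cst_continuous.
rewrite meanZ// (ge0 _ s1) => [|x]; last exact: sqr_ge0.
rewrite (ge0 _ s2) => [|x]; last exact: sqr_ge0.
rewrite (mean_cst mu_sim_sphere).
have -> : \sum_k (f (v k) + 1) ^+ 2 =
    \sum_k f (v k) ^+ 2 + (2 * (\sum_k f (v k)) + n.+1%:R).
  have -> : n.+1%:R = \sum_(k < n.+1) (1 : R) by rewrite sumr_const card_ord.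
  rewrite mulr_sumr -!big_split/=.
  by apply: eq_bigr => k _; ring.
have n1 : n.+1%:R != 0 :> R by rewrite pnatr_eq0.
have two0 : 2 != 0 :> R by rewrite pnatr_eq0.
by rewrite !mulrDr mulVf// (mulrCA _ 2) => /addrI/addIr/(mulfI two0) <-.
Qed.

Lemma mu_sim_P0 : P0 (mu_sim v).
Proof.
split; first exact: mu_sim_sphere.
apply/rowP => i; rewrite barycenterE mean_mu_sim; last exact: continuous_coord.
have /rowP/(_ i) := regular_simplex_equiangular.1; rewrite summxE !mxE => vi.
by rewrite [X in _ * X]vi mulr0.
Qed.

(** The squared entries of the moment matrix add up to the mean of the squared
entries of the Gram matrix of the vertices, which is
(1 + n * (1 / n)^2) / (n + 1) = 1 / n. *)
Lemma J4_mu_sim : J4 (mu_sim v) = (4 + 4 / n%:R)%:E.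
Proof.
have [muS b0] := mu_sim_P0.
have momentE i j : moment (mu_sim v) i j =
    n.+1%:R^-1 * \sum_k v k ord0 i * v k ord0 j.
  by rewrite /moment mean_mu_sim//; exact: continuous_coord2.
rewrite (J4_moments muS b0); congr (_ + 4 * _)%:E.
transitivity (n.+1%:R^-1 ^+ 2 * \sum_k \sum_l dot (v k) (v l) ^+ 2).
  rewrite mulr_sumr.
  transitivity (\sum_i \sum_j \sum_k \sum_l n.+1%:R^-1 ^+ 2 *
      ((v k ord0 i * v k ord0 j) * (v l ord0 i * v l ord0 j))).
    apply: eq_bigr => i _; apply: eq_bigr => j _.
    rewrite momentE exprMn [X in _ * X]expr2 big_distrlr/= mulr_sumr.
    by apply: eq_bigr => k _; rewrite mulr_sumr.
  under eq_bigr do rewrite exchange_big/=.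
  rewrite exchange_big/=; apply: eq_bigr => k _.
  under eq_bigr do rewrite exchange_big/=.
  rewrite exchange_big/= mulr_sumr; apply: eq_bigr => l _.
  rewrite [X in _ * X]expr2 big_distrlr/= mulr_sumr; apply: eq_bigr => i _.
  by rewrite mulr_sumr; apply: eq_bigr => j _; ring.
transitivity (n.+1%:R^-1 ^+ 2 * \sum_(k < n.+1) (1 + n%:R * n%:R^-1 ^+ 2 : R)).
  congr (_ * _); apply: eq_bigr => k _.
  rewrite (bigD1 k)//= regular_simplex_equiangular.2 eqxx expr1n; congr (_ + _).
  rewrite (eq_bigr (fun=> n%:R^-1 ^+ 2)); last first.
    move=> l lk; rewrite regular_simplex_equiangular.2 eq_sym (negbTE lk).
    by rewrite sqrrN.
  by rewrite sumr_const cardC1 card_ord -[LHS]mulr_natl.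
rewrite sumr_const card_ord -[X in _ * X]mulr_natl -natr1; field.
by rewrite nR natr1 pnatr_eq0.
Qed.

End Simplex.

(** * The uniform measure and its symmetries *)

Section UniformMeasure.
Context {R : realType}.
Variable s : nat.
Local Notation S := (@sphere R s.+2).
Local Notation H := (@hausdorff R s.+2 s.+1).

Lemma hausdorff_sphere_fin_num : H S \is a fin_num.
Proof.
rewrite ge0_fin_numE ?hausdorff_ge0//.
by apply: le_lt_trans (hausdorff_sphere_bound R s) _; rewrite ltry.
Qed.

Definition sphere_area : R := fine (H S).

Lemma sphere_area_gt0 : 0 < sphere_area.
Proof.
by rewrite -lte_fin fineK ?hausdorff_sphere_fin_num ?hausdorff_sphere_gt0.
Qed.

Lemma inve_sphere_area : ((H S)^-1 = (sphere_area^-1)%:E)%E.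
Proof.
rewrite -[in LHS](fineK hausdorff_sphere_fin_num) inver ifF//.
by apply/negbTE; rewrite gt_eqF// sphere_area_gt0.
Qed.

Definition uniform_measure (A : set (borelRn R s.+2)) : \bar R :=
  ((sphere_area^-1)%:E * H (A `&` S))%E.

Let uniform_measure0 : uniform_measure set0 = 0%E.
Proof. by rewrite /uniform_measure set0I hausdorff0 mule0. Qed.

Let uniform_measure_ge0 A : (0 <= uniform_measure A)%E.
Proof.
rewrite mule_ge0 ?hausdorff_ge0// lee_fin invr_ge0 ltW//.
exact: sphere_area_gt0.
Qed.

Let uniform_measure_sigma_additive : semi_sigma_additive uniform_measure.
Proof.
move=> F mF tF _; rewrite /uniform_measure.
rewrite (_ : (fun N => _) = (fun N => (sphere_area^-1)%:E
    * \sum_(0 <= k < N) H (F k `&` S))%E); last first.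
  apply/funext => N; rewrite ge0_sume_distrr// => k _.
  exact: hausdorff_ge0.
apply: cvgeZl => //.
apply: (@hausdorff_sigma_additive R s.+2 s S F _ mF tF).
exact: measurable_sphere.
Qed.

HB.instance Definition _ := isMeasure.Build _ _ _ uniform_measure
  uniform_measure0 uniform_measure_ge0 uniform_measure_sigma_additive.

Let uniform_measure_setT : uniform_measure setT = 1%E.
Proof.
rewrite /uniform_measure setTI -(fineK hausdorff_sphere_fin_num) -EFinM.
by rewrite mulVf// gt_eqF// sphere_area_gt0.
Qed.

HB.instance Definition _ := Measure_isProbability.Build _ _ _ uniform_measure
  uniform_measure_setT.

Lemma is_uniform_uniform_measure : is_uniform (uniform_measure : probability _ _).
Proof. by move=> A mA; rewrite /= inve_sphere_area. Qed.

End UniformMeasure.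

Section SignedPermutation.
Context {R : realType} {n : nat}.
Variables (e : 'I_n -> bool) (p : 'I_n -> 'I_n).
Hypotheses (pK : involutive p) (ep : forall k, e (p k) = e k).
Implicit Types (x y : 'rV[R]_n) (A U : set 'rV[R]_n).

(** These maps include the coordinate reflections and transpositions, and being
involutive isometries they make every inequality below an equality. *)
Definition signed_perm x : 'rV[R]_n := \row_k ((-1) ^+ e k * x ord0 (p k)).
Local Notation g := signed_perm.

Lemma signed_permK : involutive g.
Proof.
by move=> x; apply/rowP => k; rewrite !mxE pK ep mulrA -expr2 sqrr_sign mul1r.
Qed.

Lemma signed_permB x y : g x - g y = g (x - y).
Proof. by apply/rowP => k; rewrite !mxE mulrBr. Qed.

Lemma enorm_signed_perm x : enorm (g x) = enorm x.
Proof.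
rewrite /enorm (reindex_inj (inv_inj pK))/=; congr Num.sqrt.
by apply: eq_bigr => k _; rewrite mxE pK exprMn sqrr_sign mul1r.
Qed.

Lemma norm_signed_perm_le x : `|g x| <= `|x|.
Proof.
rewrite [leLHS]mx_normrE; apply/bigmax_leP; split=> // -[i j] _ /=.
by rewrite ord1 mxE normrM normrX normrN1 expr1n mul1r norm_coord_le.
Qed.

Lemma continuous_signed_perm : continuous g.
Proof.
move=> x U /= /nbhs_ballP[r r0 rU]; apply/nbhs_ballP; exists r => // y.
rewrite -ball_normE /= => xy; apply: rU; rewrite -ball_normE /=.
by rewrite signed_permB (le_lt_trans (norm_signed_perm_le _)).
Qed.

Lemma signed_perm_sphere : g @^-1` (@sphere R n) = @sphere R n.
Proof.
by apply/seteqP; split => x; rewrite /sphere /= enorm_signed_perm.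
Qed.

Lemma diam_signed_perm U : diam (g @^-1` U) = diam U.
Proof.
suff le V : (diam (g @^-1` V) <= diam V)%E.
  apply/eqP; rewrite eq_le le /=.
  have -> : U = g @^-1` (g @^-1` U) :> set _.
    by apply/seteqP; split => x /=; rewrite signed_permK.
  by rewrite [leRHS](_ : _ = diam (g @^-1` U)) ?le//; congr diam;
    apply/seteqP; split => x /=; rewrite signed_permK.
apply: diam_le; first exact: diam_ge0.
move=> x y Vx Vy; rewrite -enorm_signed_perm -signed_permB.
exact: enorm_le_diam.
Qed.

Lemma hausdorff_signed_perm s A : hausdorff s (g @^-1` A) = hausdorff s A.
Proof.
suff le V : (hausdorff s (g @^-1` V) <= hausdorff s V)%E.
  apply/eqP; rewrite eq_le le /=.
  rewrite [X in (hausdorff _ X <= _)%E](_ : A = g @^-1` (g @^-1` A)) ?le//.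
  by apply/seteqP; split => x /=; rewrite signed_permK.
apply: ge_ereal_sup => _ [d d0 <-].
apply: le_trans (content_le_hausdorff s V d0).
apply: le_ereal_inf_tmp => _ [F [VF Fd] <-]; apply: ereal_inf_lbound.
exists (fun k => g @^-1` F k); last first.
  by apply: eq_eseriesr => k _; rewrite diam_signed_perm.
split=> [x /VF[k _ Fk]|k]; first by exists k.
by rewrite diam_signed_perm.
Qed.

Let gB : borelRn R n -> borelRn R n := g.

Lemma measurable_signed_perm : measurable_fun setT gB.
Proof.
apply: (@measurability _ _ (borelRn R n) (borelRn R n) setT gB (@open 'rV[R]_n)) => [//|_ [U oU <-]].
rewrite setTI; apply: borel_open.
by move/continuousP : continuous_signed_perm; exact.
Qed.

Variable sigma : probability (borelRn R n) R.
Hypothesis sigma_uniform : is_uniform sigma.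

Lemma uniform_signed_perm (A : set (borelRn R n)) : measurable A ->
  sigma (gB @^-1` A) = sigma A.
Proof.
move=> mA; have mgA : measurable (gB @^-1` A).
  by rewrite -[X in measurable X]setTI; exact: measurable_signed_perm.
rewrite !sigma_uniform//; congr (_ * _)%E.
by rewrite -[in RHS]hausdorff_signed_perm preimage_setI signed_perm_sphere.
Qed.

Lemma mean_signed_perm f : continuous f ->
  mean sigma (f \o g) = mean sigma f.
Proof.
move=> cf; have cfg : continuous (f \o g).
  by move=> x; apply: continuous_comp; [exact: continuous_signed_perm|exact: cf].
have mS := @measurable_sphere R n.
congr fine; transitivity
    (\int[pushforward sigma gB]_(v in @sphere R n) (f v)%:E)%E.
  rewrite (integral_pushforward measurable_signed_perm)//.
  - by rewrite signed_perm_sphere.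
  - by apply/measurable_EFinP; exact: continuous_borel.
  - by rewrite signed_perm_sphere; exact: sphere_integrable.
apply: eq_measure_integral; first exact: measurable_signed_perm.
by move=> ? A mA _; exact: uniform_signed_perm.
Qed.

End SignedPermutation.

Section UniformMinimizes.
Context {R : realType}.
Variable s : nat.
Local Notation n := s.+2.
Variable sigma : probability (borelRn R n) R.
Hypothesis sigma_uniform : is_uniform sigma.

Lemma uniform_sphere : sigma (@sphere R n) = 1%E.
Proof.
rewrite sigma_uniform; last exact: measurable_sphere.
rewrite setIid inve_sphere_area -(fineK (hausdorff_sphere_fin_num s)) -EFinM.
by rewrite mulVf// gt_eqF// sphere_area_gt0.
Qed.

Let reflect_mean i (f : 'rV[R]_n -> R) : continuous f ->
  (forall x, f (signed_perm (pred1 i) id x) = - f x) -> mean sigma f = 0.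
Proof.
move=> cf fN.
have := mean_signed_perm (e := pred1 i) (p := id) (fun=> erefl) (fun=> erefl)
  sigma_uniform cf.
rewrite (@eq_mean _ _ _ _ (fun v => -1 * f v)); last first.
  by move=> v _ /=; rewrite fN mulN1r.
by rewrite meanZ// => H; lra.
Qed.

Lemma uniform_P0 : P0 sigma.
Proof.
split; first exact: uniform_sphere.
apply/rowP => i; rewrite barycenterE mxE.
apply: (@reflect_mean i); first exact: continuous_coord.
by move=> x; rewrite /coord mxE /= eqxx expr1 mulN1r.
Qed.

(** Reflecting the [i]-th coordinate changes the sign of v_i v_j for j <> i, and
transposing [i] and [k] exchanges v_i^2 and v_k^2. *)
Lemma uniform_isotropic : isotropic sigma.
Proof.
apply/isotropicP => i j.
have moment_diag k : moment sigma k k = moment sigma i i.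
  have := mean_signed_perm (e := xpred0) (p := tperm i k) (tpermK i k)
    (fun=> erefl) sigma_uniform (@continuous_coord2 R n i i).
  rewrite -/(moment sigma i i) => <-; apply: eq_mean => v _ /=.
  by rewrite !mxE tpermL expr0 !mul1r.
case: eqVneq => [<-|ij]; last first.
  rewrite mulr0; apply: (@reflect_mean i); first exact: continuous_coord2.
  by move=> x; rewrite !mxE /= eqxx eq_sym (negbTE ij) expr1 expr0; ring.
have := trace_moment uniform_sphere.
rewrite (eq_bigr (fun=> moment sigma i i)) => [|k _]; last exact: moment_diag.
rewrite sumr_const card_ord -[LHS]mulr_natl mulr1 => nM.
by apply: (@mulfI _ n%:R); rewrite ?pnatr_eq0// nM divff// pnatr_eq0.
Qed.

End UniformMinimizes.

(** * Minimizers *)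

Section Minimizers.
Context {R : realType} {n : nat}.
Hypothesis n_gt0 : (0 < n)%N.

Lemma minimizes_J4P (mu : probability (borelRn R n) R) : P0 mu ->
  minimizes_J4 mu <-> J4 mu = (4 + 4 / n%:R)%:E.
Proof.
move=> Pmu; split=> [[_ mu_min]|J4mu].
  apply/eqP; rewrite eq_le J4_ge// andbT.
  have simplex := regular_simplex_exists (R := R) n_gt0.
  by rewrite -(J4_mu_sim n_gt0 simplex) mu_min//; exact: mu_sim_P0.
by split=> // nu Pnu; rewrite J4mu J4_ge.
Qed.

Lemma c4E : c4 R n = (4 + 4 / n%:R)%:E.
Proof.
apply/eqP; rewrite eq_le; apply/andP; split.
  have simplex := regular_simplex_exists (R := R) n_gt0.
  rewrite -(J4_mu_sim n_gt0 simplex); apply: ereal_inf_lbound.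
  by eexists; [exact: (mu_sim_P0 n_gt0 simplex)|].
by apply: le_ereal_inf_tmp => _ [mu Pmu <-]; exact: J4_ge.
Qed.

End Minimizers.

Theorem proposition4p9 (R : realType) (n : nat) (hn : (2 <= n)%N) :
  [/\ c4 R n = (4 + 4 / n%:R)%:E,
      (forall mu : probability (borelRn R n) R,
         P0 mu -> (minimizes_J4 mu <-> isotropic mu)),
      ((exists sigma : probability (borelRn R n) R, is_uniform sigma) /\
       forall sigma : probability (borelRn R n) R,
         is_uniform sigma -> minimizes_J4 sigma) &
      ((exists v : 'I_n.+1 -> 'rV[R]_n, regular_simplex v) /\
       forall v : 'I_n.+1 -> 'rV[R]_n,
         regular_simplex v -> minimizes_J4 (mu_sim v))].
Proof.
have n_gt0 : (0 < n)%N by exact: ltnW.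
have minP (mu : probability (borelRn R n) R) : P0 mu ->
    minimizes_J4 mu <-> isotropic mu.
  by move=> Pmu; rewrite minimizes_J4P// J4_eq_isotropic.
split.
- exact: c4E.
- exact: minP.
- case: n hn {n_gt0} minP => [//|[//|s]] _ minP; split.
    by exists (@uniform_measure R s); exact: is_uniform_uniform_measure.
  move=> sigma sU; apply/minP; first exact: uniform_P0.
  exact: uniform_isotropic.
- split; first by exists simplex_vertex; exact: regular_simplex_exists.
  move=> v vs; apply/minimizes_J4P => //; first exact: mu_sim_P0.
  exact: J4_mu_sim.
Qed.
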